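(* Let $a\ge0$ and $\gamma_1,\gamma_2\in\mathbb{N}_0$. There exists a positive constant $M_9(\gamma_1,\gamma_2)$ such that for every $f\in C_{\gamma_1,\gamma_2}(I)$, all $(x,y)\in I$ and all $n_1,n_2\in\mathbb{N}$, $$\omega_{\gamma_1,\gamma_2}(x,y)\,|K_{n_1,n_2}^a(f;x,y)-f(x,y)|\le M_9(\gamma_1,\gamma_2)\;\omega\Big(f,C_{\gamma_1,\gamma_2};\frac{\delta_{n_1}^a(x)}{\sqrt{n_1+1}},\frac{\delta_{n_2}^a(y)}{\sqrt{n_2+1}}\Big).$$
   Context: $I=[0,\infty)\times[0,\infty)$, $\mathbb{N}=\{1,2,\dots\}$, $\mathbb{N}_0=\mathbb{N}\cup\{0\}$; $a\ge0$ is a fixed real parameter (constants may depend on it); functions are real-valued. Operators: let $(n)_0=1$, $(n)_i=n(n+1)\cdots(n+i-1)$ for $i\ge1$, $P_k(n,a)=\sum_{i=0}^{k}\binom{k}{i}(n)_i a^{k-i}$, and $$W_{n,k}^a(x)=e^{-\frac{ax}{1+x}}\frac{P_k(n,a)}{k!}\frac{x^k}{(1+x)^{n+k}},\qquad x\ge0,$$ (with $x^0=1$). Put $W^a_{n_1,n_2,k_1,k_2}(x,y)=W^a_{n_1,k_1}(x)W^a_{n_2,k_2}(y)$ and $$K_{n_1,n_2}^a(f;x,y)=(n_1+1)(n_2+1)\sum_{k_1=0}^\infty\sum_{k_2=0}^\infty W^a_{n_1,n_2,k_1,k_2}(x,y)\int_{\frac{k_2}{n_2+1}}^{\frac{k_2+1}{n_2+1}}\int_{\frac{k_1}{n_1+1}}^{\frac{k_1+1}{n_1+1}}f(u,v)\,du\,dv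 .$$ Weights and spaces: $\omega_\gamma(x)=(1+x^\gamma)^{-1}$ for $\gamma\in\mathbb{N}_0$ (with $x^0=1$), $\omega_{\gamma_1,\gamma_2}(x,y)=\omega_{\gamma_1}(x)\omega_{\gamma_2}(y)$. $C_{\gamma_1,\gamma_2}(I)$ is the set of $f\in C(I)$ such that $\omega_{\gamma_1,\gamma_2}f$ is bounded and uniformly continuous on $I$, with norm $\|f\|_{\gamma_1,\gamma_2}=\sup_{(x,y)\in I}|f(x,y)|\,\omega_{\gamma_1,\gamma_2}(x,y)$. Modulus of continuity: for $f\in C_{\gamma_1,\gamma_2}(I)$, $$\omega(f,C_{\gamma_1,\gamma_2};t,s)=\sup_{0<h<t,\ 0<\delta<s}\|\Delta_{h,\delta}f\|_{\gamma_1,\gamma_2},\qquad \Delta_{h,\delta}f(x,y)=f(x+h,y+\delta)-f(x,y).$$ For $x\ge 0$, $\delta_n^a(x)=\sqrt{x(1+x)+\frac{(1+a)^2}{n+1}}$. *)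

(* Defs.v *)
From Stdlib Require Import Reals Factorial.
From Coquelicot Require Import Coquelicot.
Open Scope R_scope.

(* Functions on [quadrant] are represented by total functions [R * R -> R];
   every notion below only depends on their values on [quadrant]. *)
Definition quadrant (p : R * R) : Prop := 0 <= fst p /\ 0 <= snd p.

(* (n)_i = n (n+1) ... (n+i-1) *)
Fixpoint rising (n i : nat) : nat :=
  match i with
  | O => 1%nat
  | S j => (rising n j * (n + j))%nat
  end.

Definition P (k n : nat) (a : R) : R :=
  sum_f_R0 (fun i => Binomial.C k i * INR (rising n i) * a ^ (k - i)) k.

Definition W (a : R) (n k : nat) (x : R) : R :=
  exp (- (a * x / (1 + x))) * (P k n a / INR (fact k)) *
  (x ^ k / (1 + x) ^ (n + k)).

Definition W2 (a : R) (n1 n2 k1 k2 : nat) (x y : R) : R :=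
  W a n1 k1 x * W a n2 k2 y.

Definition K (a : R) (n1 n2 : nat) (f : R * R -> R) (x y : R) : R :=
  INR (n1 + 1) * INR (n2 + 1) *
  Series (fun k1 => Series (fun k2 =>
    W2 a n1 n2 k1 k2 x y *
    RInt (fun v =>
      RInt (fun u => f (u, v))
        (INR k1 / INR (n1 + 1)) (INR (k1 + 1) / INR (n1 + 1)))
      (INR k2 / INR (n2 + 1)) (INR (k2 + 1) / INR (n2 + 1)))).

Definition weight (g : nat) (x : R) : R := / (1 + x ^ g).

Definition weight2 (g1 g2 : nat) (p : R * R) : R :=
  weight g1 (fst p) * weight g2 (snd p).

Definition bounded_on {T : Type} (D : T -> Prop) (f : T -> R) : Prop :=
  exists B : R, forall p, D p -> Rabs (f p) <= B.

(* [ball] on [R * R] is the ball of the sup metric. *)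
Definition unif_continuous_on {T U : UniformSpace} (D : T -> Prop) (f : T -> U) :
    Prop :=
  forall eps : posreal, exists delta : posreal,
    forall p q, D p -> D q -> ball p delta q -> ball (f p) eps (f q).

Definition weighted_C (g1 g2 : nat) (f : R * R -> R) : Prop :=
  continuous_on quadrant f /\
  bounded_on quadrant (fun p => weight2 g1 g2 p * f p) /\
  unif_continuous_on quadrant (fun p => weight2 g1 g2 p * f p).

(* Suprema are taken in [Rbar], so that no finiteness has to be presupposed. *)
Definition weighted_norm (g1 g2 : nat) (f : R * R -> R) : Rbar :=
  Lub_Rbar (fun r => exists p, quadrant p /\ r = Rabs (f p) * weight2 g1 g2 p).

Definition Delta (h d : R) (f : R * R -> R) : R * R -> R :=
  fun p => f (fst p + h, snd p + d) - f p.

Definition modulus (g1 g2 : nat) (f : R * R -> R) (t s : R) : Rbar :=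
  Rbar_lub (fun r => exists h d, 0 < h < t /\ 0 < d < s /\
    r = weighted_norm g1 g2 (Delta h d f)).

Definition delta (a : R) (n : nat) (x : R) : R :=
  sqrt (x * (1 + x) + (1 + a) ^ 2 / INR (n + 1)).

(* Main.v *)
Require Import Defs.
From Stdlib Require Import Reals Factorial Lra Lia.
From Coquelicot Require Import Coquelicot.
Open Scope R_scope.

(** The weights [W a n k x] are the probabilities [Prob (X = k)], where [X] is
    the sum of a negative binomial variable of mean [n x] and an independent
    Poisson variable of mean [a x / (1 + x)]; the operator is the expectation
    of the mean of [f] over a random grid cell.  So everything comes down to
    bounding [f (u, v) - f (x, y)] for [(u, v)] in the cell of index [(k1, k2)]
    by a product of a function of [k1] and a function of [k2], each having an
    expectation that is bounded uniformly in [x] and [n].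

    The pointwise bound ([two_point_le]).  The modulus [w] only controls shifts
    that are positive in both coordinates, so [(x, y)] and [(u, v)] are both
    joined to a point lying above both of them, in equal steps shorter than the
    arguments [t], [s] of the modulus.  About [1 + |u - x| / t + |v - y| / s]
    steps suffice, and each costs [w] times the inverse weight at the upper
    point, whence
    [|f (u, v) - f (x, y)| <= 6 w
       (1 + |u - x| / t) (1 + (u + x + 1) ^ g1)
       (1 + |v - y| / s) (1 + (v + y + 1) ^ g2)].

    The moment bound.  Since [1 + r <= 2 + r ^ 2], the factor
    [1 + |u - x| / t] is at most a multiple of [dispersion n x k / scale n x],
    where [scale n x = n x (1 + x) + 1] is the order of magnitude of the
    variance of [X] and [dispersion n x k = (k - n x) ^ 2 + scale n x].  It is
    thus enough that the expectation of [dispersion n x X * (X + 1) ^ g] is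
    [O ((n (1 + x)) ^ g * scale n x)] ([weighted_moment_bound]).  This follows
    by induction on [g] from the single identity
    [E_n (X g(X)) = a x / (1 + x) E_n (g (X + 1)) + n x E_(n+1) (g (X + 1))]:
    each factor [X] is traded for a factor of order [n (1 + x)] and a shift of
    the index, and the dispersion changes by a bounded factor under such a
    shift.  The case [g = 0] is the exact variance, computed by the same
    identity.

    When the modulus is infinite, the inequality is trivial; when it is finite,
    the two bounds also give the convergence of the series. *)

(** * The recurrence and the total mass of the weights *)
Lemma rising_S_l (n i : nat) : rising n (S i) = (n * rising (S n) i)%nat.
Proof.
induction i as [|i IH]; [simpl; lia|].
change (rising n (S (S i))) with (rising n (S i) * (n + S i))%nat.
rewrite IH; simpl; lia.
Qed.

(** Pascal's rule, together with [(n)_(i+1) = n (n+1)_i]. *)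
Lemma P_S (k n : nat) (a : R) :
  P (S k) n a = a * P k n a + INR n * P k (S n) a.
Proof.
assert (C0 : forall m, Binomial.C m 0 = 1).
{ intros m; unfold Binomial.C; rewrite Nat.sub_0_r; simpl; field.
  apply INR_fact_neq_0. }
assert (Cn : forall m, Binomial.C m m = 1).
{ intros m; unfold Binomial.C; rewrite Nat.sub_diag; simpl; field.
  apply INR_fact_neq_0. }
assert (E : INR n * P k (S n) a =
  sum_f_R0 (fun i => Binomial.C k i * INR (rising n (S i)) * a ^ (k - i)) k).
{ unfold P; rewrite scal_sum; apply sum_eq; intros i _.
  rewrite rising_S_l, mult_INR; ring. }
rewrite E; clear E; unfold P.
rewrite decomp_sum by lia; simpl pred.
destruct k as [|k].
{ cbn [sum_f_R0]; rewrite !C0, !Cn; simpl; ring. }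
rewrite (decomp_sum
  (fun i => Binomial.C (S k) i * INR (rising n i) * a ^ (S k - i)) (S k))
  by lia; simpl pred.
rewrite !tech5, !C0, !Cn, Rmult_plus_distr_l, scal_sum, !Nat.sub_diag.
rewrite (sum_eq _ (fun i =>
    Binomial.C (S k) i * INR (rising n (S i)) * a ^ (S k - i) +
    Binomial.C (S k) (S i) * INR (rising n (S i)) * a ^ (S k - S i) * a) k).
- rewrite sum_plus, !Nat.sub_0_r.
  change (a ^ S (S k)) with (a * a ^ S k); simpl (rising n 0); simpl INR; ring.
- intros i Hi; rewrite <- pascal by lia.
  replace (S (S k) - S i)%nat with (S (k - i)) by lia.
  replace (S k - i)%nat with (S (k - i)) by lia.
  replace (S k - S i)%nat with (k - i)%nat by lia.
  simpl (a ^ S (k - i)); ring.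
Qed.

Lemma P_nonneg (k n : nat) (a : R) : 0 <= a -> 0 <= P k n a.
Proof.
intros Ha; unfold P; apply cond_pos_sum; intros i.
apply Rmult_le_pos; [apply Rmult_le_pos|apply pow_le, Ha]; [|apply pos_INR].
unfold Binomial.C; apply Rdiv_le_0_compat; [apply pos_INR|].
apply Rmult_lt_0_compat; apply INR_fact_lt_0.
Qed.

Lemma W_nonneg (a : R) (n k : nat) (x : R) : 0 <= a -> 0 <= x -> 0 <= W a n k x.
Proof.
intros Ha Hx; unfold W.
apply Rmult_le_pos; [apply Rmult_le_pos|].
- left; apply exp_pos.
- apply Rdiv_le_0_compat; [now apply P_nonneg|apply INR_fact_lt_0].
- apply Rdiv_le_0_compat; [now apply pow_le|apply pow_lt; lra].
Qed.

(** Multiplying a power series by [1 / (1 - t)] sums its coefficients; this is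
    the coefficientwise form of [(1 - t)^-(n+1) = (1 - t)^-n / (1 - t)]. *)
Lemma rising_fact_sum (n i : nat) :
  sum_f_R0 (fun j => INR (rising n j) / INR (fact j)) i =
  INR (rising (S n) i) / INR (fact i).
Proof.
induction i as [|i IH]; [simpl; field|].
rewrite tech5, IH, (rising_S_l n i).
change (rising (S n) (S i)) with (rising (S n) i * (S n + i))%nat.
rewrite fact_simpl, !mult_INR, plus_INR, !S_INR.
pose proof (INR_fact_neq_0 i); pose proof (pos_INR i).
field; split; [assumption|lra].
Qed.

(** The negative binomial series. *)
Lemma is_series_rising (n : nat) (t : R) : 0 <= t < 1 ->
  is_series (fun i => INR (rising n i) / INR (fact i) * t ^ i) (/ (1 - t) ^ n).
Proof.
intros Ht; induction n as [|n IH].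
- simpl; rewrite Rinv_1.
  apply (is_series_decr_1 (V := R_NormedModule)).
  replace (plus _ _) with 0 by (unfold plus, opp; simpl; field).
  apply (is_series_ext (fun _ => 0)).
  + intros i; rewrite rising_S_l; simpl; unfold Rdiv; ring.
  + apply is_series_Reals; intros e He; exists 0%nat; intros m _.
    rewrite sum_cte; unfold Rdist; rewrite Rmult_0_l, Rminus_0_r, Rabs_R0; lra.
- replace (/ (1 - t) ^ S n) with (/ (1 - t) ^ n * / (1 - t))
    by (simpl; field; split; [apply pow_nonzero|]; lra).
  assert (G : is_series (fun j => t ^ j) (/ (1 - t))).
  { apply is_series_geom; rewrite Rabs_pos_eq; lra. }
  refine (is_series_ext _ _ _ _ (is_series_mult_pos _ _ _ _ IH G _ _)).
  + intros i; rewrite <- rising_fact_sum.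
    rewrite Rmult_comm, scal_sum; apply sum_eq; intros j Hj.
    replace (t ^ i) with (t ^ j * t ^ (i - j))
      by (rewrite <- pow_add; f_equal; lia); ring.
  + intros i; apply Rmult_le_pos; [|apply pow_le; lra].
    apply Rdiv_le_0_compat; [apply pos_INR|apply INR_fact_lt_0].
  + intros i; apply pow_le; lra.
Qed.

(** With [t = x / (1 + x)], the numbers [P k n a / k!] are the Taylor
    coefficients of [exp (a t) / (1 - t) ^ n], because [P] is the binomial
    convolution of the rising factorials and the powers of [a]. *)
Lemma is_series_W (a : R) (n : nat) (x : R) : 0 <= a -> 0 <= x ->
  is_series (fun k => W a n k x) 1.
Proof.
intros Ha Hx; set (t := x / (1 + x)).
assert (Ht : 0 <= t < 1).
{ unfold t; split; [apply Rdiv_le_0_compat; lra|].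
  apply (Rmult_lt_reg_r (1 + x)); [lra|]; field_simplify; lra. }
assert (E : is_series (fun j => / INR (fact j) * (a * t) ^ j) (exp (a * t))).
{ apply is_pseries_R, is_exp_Reals. }
assert (Hf := INR_fact_lt_0).
assert (M := is_series_mult_pos _ _ _ _ (is_series_rising n t Ht) E).
assert (N : 1 = scal (exp (- (a * t)) / (1 + x) ^ n)
             (/ (1 - t) ^ n * exp (a * t))).
{ unfold scal; simpl; unfold mult; simpl.
  replace (1 - t) with (/ (1 + x)) by (unfold t; field; lra).
  rewrite pow_inv, Rinv_inv, exp_Ropp.
  field; split; [apply Rgt_not_eq, exp_pos|apply pow_nonzero; lra]. }
rewrite N.
refine (is_series_ext _ _ _ _ (is_series_scal _ _ _ (M _ _))).
- intros k; unfold scal; simpl; unfold mult; simpl.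
  replace (W a n k x) with
    (exp (- (a * t)) / (1 + x) ^ n * (P k n a / INR (fact k) * t ^ k)).
  + f_equal; unfold P, Rdiv.
    rewrite Rmult_assoc, (Rmult_comm (sum_f_R0 _ _)), scal_sum.
    apply sum_eq; intros i Hi.
    unfold Binomial.C; rewrite Rpow_mult_distr.
    replace (t ^ k) with (t ^ i * t ^ (k - i))
      by (rewrite <- pow_add; f_equal; lia).
    field; repeat split; apply Rgt_not_eq, Hf.
  + unfold W, t.
    replace (a * x / (1 + x)) with (a * (x / (1 + x))) by (field; lra).
    unfold Rdiv at 4; rewrite Rpow_mult_distr, pow_inv, pow_add.
    field; repeat split; try (apply pow_nonzero; lra); try lra.
    apply Rgt_not_eq, Hf.
- intros i; apply Rmult_le_pos; [|apply pow_le; lra].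
  apply Rdiv_le_0_compat; [apply pos_INR|apply Hf].
- intros i; apply Rmult_le_pos; [left; apply Rinv_0_lt_compat, Hf|].
  apply pow_le, Rmult_le_pos; lra.
Qed.

(** The source of all moment estimates.  On generating functions it says that
    [G_n(t) = exp (a t) / (1 - t) ^ n] satisfies [G_n' = a G_n + n G_(n+1)]. *)
Lemma W_S (a : R) (n k : nat) (x : R) : 0 <= x ->
  INR (S k) * W a n (S k) x =
  a * (x / (1 + x)) * W a n k x + INR n * x * W a (S n) k x.
Proof.
intros Hx; unfold W; rewrite P_S, fact_simpl, mult_INR.
replace (n + S k)%nat with (S (n + k)) by lia.
simpl (S n + k)%nat; simpl ((1 + x) ^ S _); simpl (x ^ S k).
pose proof (INR_fact_neq_0 k); pose proof (pos_INR k).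
assert (INR (S k) <> 0) by (apply not_0_INR; lia).
field; repeat split; try assumption; try lra; apply pow_nonzero; lra.
Qed.

(** * Nonnegative series with bounded partial sums *)

(** For nonnegative terms, a bound on all partial sums expresses convergence and
    a bound on the sum at once, and it is monotone in the terms. *)
Definition partial_sums_le (u : nat -> R) (B : R) : Prop :=
  forall N, sum_n u N <= B.

Lemma partial_sums_le_weaken (u v : nat -> R) (A B : R) :
  (forall k, u k <= v k) -> A <= B ->
  partial_sums_le v A -> partial_sums_le u B.
Proof.
intros H HAB HA N; apply Rle_trans with (2 := HAB).
apply Rle_trans with (2 := HA N); apply sum_n_m_le, H.
Qed.

Lemma partial_sums_le_plus (u v : nat -> R) (A B : R) :
  partial_sums_le u A -> partial_sums_le v B ->
  partial_sums_le (fun k => u k + v k) (A + B).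
Proof.
intros HA HB N; rewrite (sum_n_plus (G := R_AbelianGroup)).
apply Rplus_le_compat; [apply HA|apply HB].
Qed.

Lemma partial_sums_le_scal (u : nat -> R) (c A : R) : 0 <= c ->
  partial_sums_le u A -> partial_sums_le (fun k => c * u k) (c * A).
Proof.
intros Hc HA N.
change (sum_n (fun k => mult (K := R_Ring) c (u k)) N <= c * A).
rewrite sum_n_mult_l.
apply Rmult_le_compat_l; [assumption|apply HA].
Qed.

Lemma is_series_partial_sums_le (u : nat -> R) (l : R) :
  (forall k, 0 <= u k) -> is_series u l -> partial_sums_le u l.
Proof.
intros Hu Hl N; refine (is_lim_seq_incr_compare (sum_n u) l Hl _ N).
clear N; intros N; rewrite sum_Sn; unfold plus; simpl.
specialize (Hu (S N)); lra.
Qed.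

Lemma partial_sums_le_is_series (u : nat -> R) (A : R) :
  (forall k, 0 <= u k) -> partial_sums_le u A ->
  exists l : R, is_series u l /\ l <= A.
Proof.
intros Hu HA.
destruct (ex_finite_lim_seq_incr (sum_n u) A) as [l Hl].
- intros n; rewrite sum_Sn; specialize (Hu (S n)).
  rewrite <- Rplus_0_r at 1; apply Rplus_le_compat_l, Hu.
- exact HA.
- exists l; split; [exact Hl|].
  exact (is_lim_seq_le _ _ (Finite l) (Finite A) HA Hl (is_lim_seq_const A)).
Qed.

(** * Moments of the weights *)

(** The recurrence [W_S] in terms of expectations: a factor [k] under the
    expectation becomes a shift [k -> k + 1]. *)
Lemma is_series_W_mul_index (a : R) (n : nat) (x : R) (g : nat -> R)
    (S1 S2 : R) :
  0 <= x ->
  is_series (fun k => W a n k x * g (S k)) S1 ->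
  is_series (fun k => W a (S n) k x * g (S k)) S2 ->
  is_series (fun k => W a n k x * (INR k * g k))
    (a * (x / (1 + x)) * S1 + INR n * x * S2).
Proof.
intros Hx H1 H2; apply (is_series_decr_1 (V := R_NormedModule)).
replace (plus _ _) with
  (plus (scal (a * (x / (1 + x))) S1) (scal (INR n * x) S2))
  by (unfold plus, opp, scal; simpl; unfold mult; simpl; ring).
refine (is_series_ext _ _ _ _ (is_series_plus _ _ _ _
  (is_series_scal _ _ _ H1) (is_series_scal _ _ _ H2))).
intros k.
change (a * (x / (1 + x)) * (W a n k x * g (S k)) +
  INR n * x * (W a (S n) k x * g (S k)) =
  W a n (S k) x * (INR (S k) * g (S k))).
replace (W a n (S k) x * (INR (S k) * g (S k))) with
  (INR (S k) * W a n (S k) x * g (S k)) by ring.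
rewrite W_S by assumption; ring.
Qed.

(** The same identity for bounds, where cancellation is no issue and only
    partial sums have to be compared. *)
Lemma partial_sums_W_mul_index (a : R) (n : nat) (x : R) (g : nat -> R)
    (B1 B2 : R) :
  0 <= a -> 0 <= x -> (forall k, 0 <= g k) ->
  partial_sums_le (fun k => W a n k x * g (S k)) B1 ->
  partial_sums_le (fun k => W a (S n) k x * g (S k)) B2 ->
  partial_sums_le (fun k => W a n k x * (INR k * g k))
    (a * (x / (1 + x)) * B1 + INR n * x * B2).
Proof.
intros Ha Hx Hg H1 H2.
assert (Ht : 0 <= a * (x / (1 + x))).
{ apply Rmult_le_pos; [assumption|apply Rdiv_le_0_compat; lra]. }
assert (Hn : 0 <= INR n * x)
  by (apply Rmult_le_pos; [apply pos_INR|assumption]).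
assert (H := partial_sums_le_plus _ _ _ _
  (partial_sums_le_scal _ _ _ Ht H1) (partial_sums_le_scal _ _ _ Hn H2)).
intros N; apply Rle_trans with (2 := H N).
destruct N as [|N].
- rewrite !sum_O; simpl INR.
  rewrite Rmult_0_l, Rmult_0_r.
  apply Rplus_le_le_0_compat; apply Rmult_le_pos; auto;
    apply Rmult_le_pos; auto; now apply W_nonneg.
- unfold sum_n at 1; rewrite sum_Sn_m by lia; rewrite <- sum_n_m_S.
  simpl INR at 1; rewrite Rmult_0_l, Rmult_0_r.
  unfold plus; simpl plus; rewrite Rplus_0_l, sum_Sn.
  match goal with |- _ <= plus _ ?z => assert (Hz : 0 <= z) end.
  { apply Rplus_le_le_0_compat; apply Rmult_le_pos; auto;
    apply Rmult_le_pos; auto; now apply W_nonneg. }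
  match goal with |- ?u <= plus ?v _ => replace u with v end.
  + rewrite <- Rplus_0_r at 1; apply Rplus_le_compat_l, Hz.
  + apply sum_n_m_ext; intros k.
    replace (W a n (S k) x * (INR (S k) * g (S k))) with
      (INR (S k) * W a n (S k) x * g (S k)) by ring.
    rewrite W_S by assumption.
    match goal with |- ?l = ?r => change (@eq R l r) end; ring.
Qed.

Lemma is_series_W_mean (a : R) (n : nat) (x : R) : 0 <= a -> 0 <= x ->
  is_series (fun k => W a n k x * INR k) (a * (x / (1 + x)) + INR n * x).
Proof.
intros Ha Hx.
assert (H : forall m, is_series (fun k => W a m k x * 1) 1).
{ intros m; apply is_series_ext with (2 := is_series_W a m x Ha Hx).
  intros k; symmetry; apply Rmult_1_r. }
replace (a * (x / (1 + x)) + INR n * x) with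
  (a * (x / (1 + x)) * 1 + INR n * x * 1) by ring.
apply is_series_ext with
  (2 := is_series_W_mul_index a n x (fun _ => 1) 1 1 Hx (H n) (H (S n))).
intros k; now rewrite Rmult_1_r.
Qed.

Lemma is_series_W_variance (a : R) (n : nat) (x : R) : 0 <= a -> 0 <= x ->
  is_series (fun k => W a n k x * (INR k - INR n * x) ^ 2)
    ((a * (x / (1 + x))) ^ 2 + a * (x / (1 + x)) + INR n * x * (1 + x)).
Proof.
intros Ha Hx; set (t := x / (1 + x)).
assert (H : forall m, is_series (fun k => W a m k x * INR (S k))
                        (a * t + INR m * x + 1)).
{ intros m; refine (is_series_ext _ _ _ _ (is_series_plus _ _ _ _
    (is_series_W_mean a m x Ha Hx) (is_series_W a m x Ha Hx))).
  intros k; rewrite S_INR.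
  change (W a m k x * INR k + W a m k x = W a m k x * (INR k + 1)); ring. }
replace (_ + _) with
  (plus (plus (a * t * (a * t + INR n * x + 1) +
               INR n * x * (a * t + INR (S n) * x + 1))
          (scal (-2 * INR n * x) (a * t + INR n * x)))
      (scal ((INR n * x) ^ 2) 1)).
2: { rewrite S_INR; unfold plus, scal; simpl; unfold mult; simpl; ring. }
refine (is_series_ext _ _ _ _ (is_series_plus _ _ _ _ (is_series_plus _ _ _ _
  (is_series_W_mul_index a n x INR _ _ Hx (H n) (H (S n)))
  (is_series_scal _ _ _ (is_series_W_mean a n x Ha Hx)))
  (is_series_scal _ _ _ (is_series_W a n x Ha Hx)))).
intros k.
change (W a n k x * (INR k * INR k) + (-2 * INR n * x) * (W a n k x * INR k) +
  (INR n * x) ^ 2 * W a n k x = W a n k x * (INR k - INR n * x) ^ 2); ring.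
Qed.

(** For [1 <= n], up to a factor depending on [a], this is
    [(n + 1) ^ 2 * (delta a n x / sqrt (n + 1)) ^ 2], the squared argument of
    the modulus measured in grid cells. *)
Definition scale (n : nat) (x : R) : R := INR n * x * (1 + x) + 1.

(** The summand [scale n x] makes the squared deviation comparable with its
    translates: a shift of [k] by [1], or of the mean by [x], changes the
    deviation by at most a multiple of [1 + x], whose square is [O (scale)]. *)
Definition dispersion (n : nat) (x : R) (k : nat) : R :=
  (INR k - INR n * x) ^ 2 + scale n x.

Lemma scale_ge_1 (n : nat) (x : R) : 0 <= x -> 1 <= scale n x.
Proof.
intros Hx; unfold scale; pose proof (pos_INR n).
assert (0 <= INR n * x * (1 + x)) by (repeat apply Rmult_le_pos; lra); lra.
Qed.

Lemma dispersion_ge_scale (n : nat) (x : R) (k : nat) :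
  scale n x <= dispersion n x k.
Proof. unfold dispersion; pose proof (pow2_ge_0 (INR k - INR n * x)); lra. Qed.

Lemma dispersion_S_l (n : nat) (x : R) (k : nat) : 0 <= x ->
  dispersion n x (S k) <= 6 * dispersion n x k.
Proof.
intros Hx; pose proof (scale_ge_1 n x Hx); unfold dispersion; rewrite S_INR.
pose proof (pow2_ge_0 (INR k - INR n * x)).
pose proof (pow2_ge_0 (INR k - INR n * x - 1)); lra.
Qed.

Lemma dispersion_S_r (n : nat) (x : R) (k : nat) : 0 <= x ->
  dispersion n x (S k) <= 6 * dispersion (S n) x k.
Proof.
intros Hx; pose proof (scale_ge_1 n x Hx); unfold dispersion.
assert (E : scale (S n) x = scale n x + x + x * x)
  by (unfold scale; rewrite S_INR; ring).
rewrite E, !S_INR; set (d := INR k - (INR n + 1) * x).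
replace (INR k + 1 - INR n * x) with (d + (1 + x)) by (unfold d; ring).
pose proof (pow2_ge_0 (d - (1 + x))); pose proof (pow2_ge_0 x).
pose proof (pow2_ge_0 d); lra.
Qed.

(** Induction on [g], splitting [(X + 1) ^ (g + 1)] as [X (X + 1) ^ g] plus
    [(X + 1) ^ g]: the identity [partial_sums_W_mul_index] turns the first part
    into expectations of degree [g] for [n] and [n + 1], with coefficients
    [a x / (1 + x)] and [n x], both [O (n (1 + x))]. *)
Lemma weighted_moment_bound (a : R) (g : nat) : 0 <= a ->
  exists C, 0 < C /\ forall n x, (1 <= n)%nat -> 0 <= x ->
    partial_sums_le (fun k => W a n k x * (dispersion n x k * (INR k + 1) ^ g))
      (C * (INR n * (1 + x)) ^ g * scale n x).
Proof.
intros Ha; induction g as [|g [C [HC IH]]].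
- exists (a ^ 2 + a + 2); split; [pose proof (pow2_ge_0 a); lra|].
  intros n x _ Hx; set (t := x / (1 + x)).
  assert (Ht : 0 <= t <= 1).
  { unfold t; split; [apply Rdiv_le_0_compat; lra|].
    apply (Rmult_le_reg_r (1 + x)); [lra|]; field_simplify; lra. }
  assert (H1 := is_series_partial_sums_le _ _
    (fun k => W_nonneg a n k x Ha Hx) (is_series_W a n x Ha Hx)).
  assert (H2 := fun H => is_series_partial_sums_le _ _ H
    (is_series_W_variance a n x Ha Hx)).
  assert (HL := scale_ge_1 n x Hx).
  assert (HL0 : 0 <= scale n x) by lra.
  refine (partial_sums_le_weaken _ _ _ _ _ _ (partial_sums_le_plus _ _ _ _
    (H2 _) (partial_sums_le_scal _ _ _ HL0 H1))).
  + intros k; right; unfold dispersion; simpl; ring.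
  + fold t; simpl ((_ * _) ^ 0).
    assert ((a * t) ^ 2 <= a ^ 2).
    { apply pow_incr; split; [apply Rmult_le_pos; lra|].
      rewrite <- (Rmult_1_r a) at 2; apply Rmult_le_compat_l; lra. }
    assert (a * t <= a)
      by (rewrite <- (Rmult_1_r a) at 2; apply Rmult_le_compat_l; lra).
    assert (0 <= (a ^ 2 + a) * (scale n x - 1))
      by (apply Rmult_le_pos; pose proof (pow2_ge_0 a); lra).
    unfold scale in *; lra.
  + intros k; apply Rmult_le_pos; [now apply W_nonneg|apply pow2_ge_0].
- assert (Hp : 0 < 2 ^ g) by (apply pow_lt; lra).
  exists (a * (6 * 2 ^ g * C) + 6 * 2 ^ g * (C * 2 ^ g * 2) + C).
  assert (HA : 0 <= 6 * 2 ^ g * C) by (repeat apply Rmult_le_pos; lra).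
  assert (HB : 0 <= 6 * 2 ^ g * (C * 2 ^ g * 2))
    by (repeat apply Rmult_le_pos; lra).
  split; [assert (0 <= a * (6 * 2 ^ g * C)) by (now apply Rmult_le_pos); lra|].
  intros n x Hn Hx.
  assert (Hn1 : 1 <= INR n) by (now apply (le_INR 1)).
  assert (HL := scale_ge_1 n x Hx).
  set (m := INR n * (1 + x)).
  assert (Hm : 1 <= m).
  { apply Rle_trans with (1 * 1); [lra|].
    apply Rmult_le_compat; lra. }
  assert (Hmg : 0 < m ^ g) by (apply pow_lt; lra).
  assert (Hk : forall k, (INR (S k) + 1) ^ g <= 2 ^ g * (INR k + 1) ^ g).
  { intros k; rewrite <- Rpow_mult_distr, S_INR; pose proof (pos_INR k).
    apply pow_incr; lra. }
  set (G k := dispersion n x k * (INR k + 1) ^ g).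
  assert (HD : forall n k, 0 <= dispersion n x k).
  { intros n' k; pose proof (dispersion_ge_scale n' x k).
    pose proof (scale_ge_1 n' x Hx); lra. }
  assert (HG : forall k, 0 <= (INR k + 1) ^ g).
  { intros k; apply pow_le; pose proof (pos_INR k); lra. }
  assert (Hshift : forall n' k, dispersion n x (S k) <= 6 * dispersion n' x k ->
    W a n' k x * G (S k) <=
    6 * 2 ^ g * (W a n' k x * (dispersion n' x k * (INR k + 1) ^ g))).
  { intros n' k H; unfold G.
    apply Rle_trans with (W a n' k x *
      ((6 * dispersion n' x k) * (2 ^ g * (INR k + 1) ^ g))); [|right; ring].
    apply Rmult_le_compat_l; [now apply W_nonneg|].
    apply Rmult_le_compat; auto. }
  assert (H1 : partial_sums_le (fun k => W a n k x * G (S k))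
                 (6 * 2 ^ g * (C * m ^ g * scale n x))).
  { apply partial_sums_le_weaken with
      (3 := partial_sums_le_scal _ (6 * 2 ^ g) _ ltac:(lra) (IH n x Hn Hx)).
    - intros k; apply Hshift, dispersion_S_l, Hx.
    - apply Rle_refl. }
  assert (H2 : partial_sums_le (fun k => W a (S n) k x * G (S k))
                 (6 * 2 ^ g * (C * (2 ^ g * m ^ g) * (2 * scale n x)))).
  { apply partial_sums_le_weaken with
      (3 := partial_sums_le_scal _ (6 * 2 ^ g) _ ltac:(lra)
              (IH (S n) x ltac:(lia) Hx)).
    - intros k; apply Hshift, dispersion_S_r, Hx.
    - apply Rmult_le_compat_l; [lra|].
      apply Rmult_le_compat.
      + apply Rmult_le_pos; [lra|apply pow_le, Rmult_le_pos];
          [apply pos_INR|lra].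
      + pose proof (scale_ge_1 (S n) x Hx); lra.
      + apply Rmult_le_compat_l; [lra|].
        rewrite <- Rpow_mult_distr; apply pow_incr; split.
        * apply Rmult_le_pos; [apply pos_INR|lra].
        * unfold m; rewrite <- Rmult_assoc.
          apply Rmult_le_compat_r; [lra|]; rewrite S_INR; lra.
      + unfold scale; rewrite S_INR.
        assert (0 <= (INR n - 1) * (x * (1 + x)))
          by (repeat apply Rmult_le_pos; lra); lra. }
  assert (HG0 : forall k, 0 <= G k) by (intros k; now apply Rmult_le_pos).
  refine (partial_sums_le_weaken _ _ _ _ _ _ (partial_sums_le_plus _ _ _ _
    (partial_sums_W_mul_index a n x G _ _ Ha Hx HG0 H1 H2) (IH n x Hn Hx))).
  + intros k; right; unfold G; simpl; ring.
  + fold m; simpl (m ^ S g).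
    assert (Ht : a * (x / (1 + x)) <= a * m).
    { apply Rmult_le_compat_l; [assumption|]; apply Rle_trans with 1; [|lra].
      apply (Rmult_le_reg_r (1 + x)); [lra|]; field_simplify; lra. }
    assert (Hx' : INR n * x <= m) by (unfold m; apply Rmult_le_compat_l; lra).
    assert (HQ : 0 <= m ^ g * scale n x) by (apply Rmult_le_pos; lra).
    set (Q := m ^ g * scale n x) in *.
    replace (6 * 2 ^ g * (C * m ^ g * scale n x)) with (6 * 2 ^ g * C * Q)
      by (unfold Q; ring).
    replace (6 * 2 ^ g * (C * (2 ^ g * m ^ g) * (2 * scale n x))) with
      (6 * 2 ^ g * (C * 2 ^ g * 2) * Q) by (unfold Q; ring).
    replace (C * m ^ g * scale n x) with (1 * (C * Q)) by (unfold Q; ring).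
    replace (_ * (m * m ^ g) * scale n x) with
      (a * m * (6 * 2 ^ g * C * Q) + m * (6 * 2 ^ g * (C * 2 ^ g * 2) * Q) +
       m * (C * Q)) by (unfold Q; ring).
    apply Rplus_le_compat; [apply Rplus_le_compat|]; apply Rmult_le_compat_r;
      try assumption; apply Rmult_le_pos; lra.
Qed.

(** * The one-variable majorant *)

Lemma pow_plus_le (p q : R) (g : nat) : 0 <= p -> 0 <= q ->
  (p + q) ^ g <= 2 ^ g * (p ^ g + q ^ g).
Proof.
intros Hp Hq.
assert (H : forall r s, 0 <= r <= s -> (r + s) ^ g <= 2 ^ g * (r ^ g + s ^ g)).
{ intros r s Hrs; apply Rle_trans with ((2 * s) ^ g).
  - apply pow_incr; lra.
  - rewrite Rpow_mult_distr; apply Rmult_le_compat_l; [apply pow_le; lra|].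
    assert (0 <= r ^ g) by (apply pow_le; lra); lra. }
destruct (Rle_or_lt p q) as [Hpq|Hpq]; [apply H; lra|].
rewrite (Rplus_comm p), (Rplus_comm (p ^ g)); apply H; lra.
Qed.

Lemma weight_pos (g : nat) (x : R) : 0 <= x -> 0 < weight g x.
Proof.
intros Hx; apply Rinv_0_lt_compat; pose proof (pow_le x g Hx); lra.
Qed.

Lemma weight_inv (g : nat) (x : R) : 0 <= x -> (1 + x ^ g) * weight g x = 1.
Proof.
intros Hx; apply Rinv_r; pose proof (pow_le x g Hx); lra.
Qed.

Lemma weight_pow_le (g : nat) (x : R) : 0 <= x ->
  weight g x * (1 + x) ^ g <= 2 ^ g.
Proof.
intros Hx; pose proof (weight_pos g x Hx) as Hw.
apply Rle_trans with (weight g x * (2 ^ g * (1 ^ g + x ^ g))).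
- apply Rmult_le_compat_l; [lra|]; apply pow_plus_le; lra.
- right; rewrite pow1.
  replace (weight g x * (2 ^ g * (1 + x ^ g))) with
    (2 ^ g * ((1 + x ^ g) * weight g x)) by ring.
  rewrite weight_inv by assumption; ring.
Qed.

(** Up to a factor [4], a bound for what one coordinate contributes to the
    weighted increment of [f], uniform over the cell of index [k]; the power
    is taken at the right end of the cell. *)
Definition cell_majorant (g n : nat) (x : R) (k : nat) : R :=
  dispersion n x k / scale n x *
  ((1 + (INR (k + 1) / INR (n + 1) + x + 1) ^ g) * weight g x).

Lemma cell_majorant_nonneg (g n : nat) (x : R) (k : nat) : 0 <= x ->
  0 <= cell_majorant g n x k.
Proof.
intros Hx; pose proof (scale_ge_1 n x Hx); pose proof (weight_pos g x Hx).
pose proof (dispersion_ge_scale n x k).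
assert (0 <= (INR (k + 1) / INR (n + 1) + x + 1) ^ g).
{ apply pow_le; apply Rplus_le_le_0_compat; [|lra].
  apply Rplus_le_le_0_compat; [|lra].
  apply Rdiv_le_0_compat; [apply pos_INR|apply lt_0_INR; lia]. }
apply Rmult_le_pos; [apply Rdiv_le_0_compat|apply Rmult_le_pos]; lra.
Qed.

(** By [weighted_moment_bound], the dispersion times the [g]-th power of
    [(k + 1) / (n + 1)] has expectation [O ((1 + x) ^ g * scale n x)]; the weight
    absorbs the first factor and the division by [scale n x] the second. *)
Lemma W_cell_majorant_bound (a : R) (g : nat) : 0 <= a ->
  exists A, 0 < A /\ forall n x, (1 <= n)%nat -> 0 <= x ->
    partial_sums_le (fun k => W a n k x * cell_majorant g n x k) A.
Proof.
intros Ha.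
destruct (weighted_moment_bound a g Ha) as [C [HC HCg]].
destruct (weighted_moment_bound a 0 Ha) as [C0 [HC0 HC00]].
assert (Hp : 0 < 2 ^ g) by (apply pow_lt; lra).
exists (2 ^ g * 2 ^ g * (C + 2 * C0)); split.
{ repeat apply Rmult_lt_0_compat; lra. }
intros n x Hn Hx.
assert (Hn1 : 1 <= INR n) by (now apply (le_INR 1)).
assert (HL := scale_ge_1 n x Hx).
assert (Hw := weight_pos g x Hx).
assert (Hq : 1 <= (1 + x) ^ g) by (apply pow_R1_Rle; lra).
assert (Hng : 0 < INR n ^ g) by (apply pow_lt; lra).
assert (HiL : 0 < / scale n x) by (apply Rinv_0_lt_compat; lra).
assert (Hing : 0 < / INR n ^ g) by (now apply Rinv_0_lt_compat).
set (c1 := 2 ^ g * weight g x * / scale n x * / INR n ^ g).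
set (c2 := 2 * (2 ^ g * (1 + x) ^ g * weight g x * / scale n x)).
assert (Hc1 : 0 <= c1) by (unfold c1; repeat apply Rmult_le_pos; lra).
assert (Hc2 : 0 <= c2) by (unfold c2; repeat apply Rmult_le_pos; lra).
refine (partial_sums_le_weaken _ _ _ _ _ _ (partial_sums_le_plus _ _ _ _
  (partial_sums_le_scal _ c1 _ Hc1 (HCg n x Hn Hx))
  (partial_sums_le_scal _ c2 _ Hc2 (HC00 n x Hn Hx)))).
- intros k; unfold cell_majorant.
  assert (HV : 0 <= dispersion n x k)
    by (pose proof (dispersion_ge_scale n x k); lra).
  assert (HW := W_nonneg a n k x Ha Hx).
  set (p := INR (k + 1) / INR (n + 1)).
  assert (Hp0 : 0 <= p <= (INR k + 1) / INR n).
  { unfold p; rewrite !plus_INR; simpl (INR 1); pose proof (pos_INR k).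
    split; [apply Rdiv_le_0_compat; lra|].
    apply Rmult_le_compat_l; [lra|]; apply Rinv_le_contravar; lra. }
  assert (Hpow : 1 + (p + x + 1) ^ g <=
    2 ^ g * ((INR k + 1) ^ g * / INR n ^ g + 2 * (1 + x) ^ g)).
  { assert (H1 := pow_plus_le p (1 + x) g (proj1 Hp0) ltac:(lra)).
    assert (H2 := pow_incr p _ g Hp0).
    unfold Rdiv in H2; rewrite Rpow_mult_distr, pow_inv in H2.
    assert (1 <= 2 ^ g * (1 + x) ^ g).
    { apply Rle_trans with (1 * 1); [lra|].
      apply Rmult_le_compat; try lra; apply pow_R1_Rle; lra. }
    replace (p + x + 1) with (p + (1 + x)) by ring.
    assert (2 ^ g * p ^ g <= 2 ^ g * ((INR k + 1) ^ g * / INR n ^ g))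
      by (apply Rmult_le_compat_l; lra).
    lra. }
  apply Rle_trans with (W a n k x * (dispersion n x k / scale n x *
   ((2 ^ g * ((INR k + 1) ^ g * / INR n ^ g + 2 * (1 + x) ^ g)) * weight g x))).
  + apply Rmult_le_compat_l; [assumption|].
    apply Rmult_le_compat_l; [apply Rmult_le_pos; lra|].
    apply Rmult_le_compat_r; lra.
  + right; unfold c1, c2, Rdiv; simpl; ring.
- apply Rle_trans with (2 ^ g * (weight g x * (1 + x) ^ g) * (C + 2 * C0)).
  + right; unfold c1, c2; rewrite Rpow_mult_distr; simpl ((_ * _) ^ 0).
    field; lra.
  + apply Rmult_le_compat_r; [lra|]; apply Rmult_le_compat_l; [lra|].
    now apply weight_pow_le.
Qed.

Lemma delta_pos (a : R) (n : nat) (x : R) : 0 <= a -> 0 <= x ->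
  0 < delta a n x / sqrt (INR (n + 1)).
Proof.
intros Ha Hx.
assert (Hn : 0 < INR (n + 1)) by (apply lt_0_INR; lia).
apply Rdiv_lt_0_compat; apply sqrt_lt_R0; [|assumption].
apply Rplus_le_lt_0_compat; [apply Rmult_le_pos; lra|].
apply Rdiv_lt_0_compat; [apply pow_lt; lra|assumption].
Qed.

(** The first factor is linear in [|u - x| / t], whereas the moments are
    quadratic; [1 + r <= 2 + r ^ 2] bridges the two, and [t] was chosen so that
    [(t (n + 1)) ^ 2 >= scale n x]. *)
Lemma deviation_le_cell_majorant (a : R) (g n k : nat) (x u : R) :
  0 <= a -> 0 <= x -> (1 <= n)%nat ->
  INR k / INR (n + 1) <= u <= INR (k + 1) / INR (n + 1) ->
  (1 + Rabs (u - x) / (delta a n x / sqrt (INR (n + 1)))) *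
    ((1 + (u + x + 1) ^ g) * weight g x) <= 4 * cell_majorant g n x k.
Proof.
intros Ha Hx Hn Hu.
assert (Hn1 : 1 <= INR n) by (now apply (le_INR 1)).
assert (Ht := delta_pos a n x Ha Hx).
set (t := delta a n x / sqrt (INR (n + 1))) in *.
assert (Em : INR (n + 1) = INR n + 1) by (rewrite plus_INR; reflexivity).
assert (Ek : INR (k + 1) = INR k + 1) by (rewrite plus_INR; reflexivity).
set (m := INR (n + 1)) in *.
assert (Hm : 0 < m) by lra.
assert (HL := scale_ge_1 n x Hx).
assert (HV := dispersion_ge_scale n x k).
assert (Hw := weight_pos g x Hx).
assert (Hk := pos_INR k).
assert (Hu0 : 0 <= u).
{ apply Rle_trans with (2 := proj1 Hu); apply Rdiv_le_0_compat; lra. }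
(* In units of one cell, [u - x] is [k - n x] plus an error [s - x] with
   [0 <= s <= 1], and [(s - x) ^ 2 <= 1 + x ^ 2 <= scale n x]. *)
assert (Hdev : ((u - x) * m) ^ 2 <= 2 * dispersion n x k).
{ assert (Hs : 0 <= u * m - INR k <= 1).
  { destruct Hu as [H1 H2].
    apply (Rmult_le_compat_r m) in H1; [|lra].
    apply (Rmult_le_compat_r m) in H2; [|lra].
    unfold Rdiv in H1, H2; rewrite Rmult_assoc, Rinv_l, Rmult_1_r in H1, H2
      by lra.
    lra. }
  set (s := u * m - INR k) in *.
  replace ((u - x) * m) with ((INR k - INR n * x) + (s - x))
    by (unfold s; rewrite Em; ring).
  unfold dispersion, scale.
  pose proof (pow2_ge_0 ((INR k - INR n * x) - (s - x))).
  assert (0 <= (1 - s) * s) by (apply Rmult_le_pos; lra).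
  assert (0 <= s * x) by (apply Rmult_le_pos; lra).
  assert (0 <= (INR n - 1) * (x * (1 + x)))
    by (repeat apply Rmult_le_pos; lra).
  lra. }
assert (Ht2 : scale n x <= (t * m) ^ 2).
{ assert (E : t ^ 2 = (x * (1 + x) + (1 + a) ^ 2 / m) / m).
  { unfold t, Rdiv, delta; fold m; rewrite Rpow_mult_distr, pow_inv.
    rewrite !pow2_sqrt; [reflexivity|lra|].
    apply Rplus_le_le_0_compat; [apply Rmult_le_pos; lra|].
    apply Rdiv_le_0_compat; [apply pow2_ge_0|lra]. }
  rewrite Rpow_mult_distr, E.
  replace (_ * m ^ 2) with (m * (x * (1 + x)) + (1 + a) ^ 2) by (field; lra).
  unfold scale; rewrite Em.
  assert (0 <= x * (1 + x)) by (apply Rmult_le_pos; lra).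
  pose proof (pow2_ge_0 a); lra. }
set (r := Rabs (u - x) / t).
assert (Hr : r ^ 2 <= 2 * (dispersion n x k / scale n x)).
{ assert (E : r ^ 2 = ((u - x) * m) ^ 2 / (t * m) ^ 2).
  { unfold r, Rdiv; rewrite Rpow_mult_distr, pow2_abs; field; lra. }
  rewrite E; unfold Rdiv; rewrite <- Rmult_assoc.
  apply Rmult_le_compat; try assumption; [apply pow2_ge_0| |].
  - left; apply Rinv_0_lt_compat; lra.
  - apply Rinv_le_contravar; lra. }
assert (Hq : 1 <= dispersion n x k / scale n x).
{ apply (Rmult_le_reg_r (scale n x)); [lra|].
  unfold Rdiv; rewrite Rmult_assoc, Rinv_l by lra; lra. }
unfold cell_majorant; fold m; rewrite <- (Rmult_assoc 4).
assert (Hup : (u + x + 1) ^ g <= (INR (k + 1) / m + x + 1) ^ g)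
  by (apply pow_incr; lra).
assert (H0 : 0 <= (u + x + 1) ^ g) by (apply pow_le; lra).
apply Rmult_le_compat.
- assert (0 <= r); [|lra].
  apply Rdiv_le_0_compat; [apply Rabs_pos|assumption].
- apply Rmult_le_pos; lra.
- pose proof (pow2_ge_0 (r - 1 / 2)); lra.
- apply Rmult_le_compat_r; lra.
Qed.

(** * Increments of a function with finite modulus *)

Definition shifts_le (g1 g2 : nat) (f : R * R -> R) (t s w : R) : Prop :=
  forall h d p, 0 < h < t -> 0 < d < s -> quadrant p ->
    Rabs (Defs.Delta h d f p) * weight2 g1 g2 p <= w.

Lemma Rbar_lub_upper_bound (E : Rbar -> Prop) (r : Rbar) :
  E r -> Rbar_le r (Rbar_lub E).
Proof. exact (proj1 (proj2_sig (Rbar_ex_lub E)) r). Qed.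

Lemma shifts_le_modulus (g1 g2 : nat) (f : R * R -> R) (t s w : R) :
  modulus g1 g2 f t s = Finite w -> shifts_le g1 g2 f t s w.
Proof.
intros E h d p Hh Hd Hp.
assert (H1 : Rbar_le (weighted_norm g1 g2 (Defs.Delta h d f)) (Finite w)).
{ rewrite <- E; apply Rbar_lub_upper_bound; eauto. }
apply (Rbar_le_trans (Finite _) (weighted_norm g1 g2 (Defs.Delta h d f))
  (Finite w)); [|assumption].
apply (Lub_Rbar_correct (fun r => exists p, _)); eauto.
Qed.

Lemma modulus_not_m_infty (g1 g2 : nat) (f : R * R -> R) (t s : R) :
  0 < t -> 0 < s -> modulus g1 g2 f t s <> m_infty.
Proof.
intros Ht Hs E.
assert (H1 : Rbar_le (weighted_norm g1 g2 (Defs.Delta (t / 2) (s / 2) f))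
  m_infty).
{ rewrite <- E; apply Rbar_lub_upper_bound.
  exists (t / 2), (s / 2); repeat split; lra. }
assert (H2 : Rbar_le
  (Finite (Rabs (Defs.Delta (t / 2) (s / 2) f (0, 0)) * weight2 g1 g2 (0, 0)))
  (weighted_norm g1 g2 (Defs.Delta (t / 2) (s / 2) f))).
{ apply (Lub_Rbar_correct (fun r => exists p, _)); exists (0, 0).
  split; [split; simpl; lra|reflexivity]. }
exact (Rbar_le_trans _ _ _ H2 H1).
Qed.

Section Chain.

Variables (g1 g2 : nat) (f : R * R -> R) (t s w : R).
Hypothesis (Ht : 0 < t) (Hs : 0 < s) (Hf : shifts_le g1 g2 f t s w).

Let growth (x y : R) : R := (1 + x ^ g1) * (1 + y ^ g2).

Lemma growth_le (x y X Y : R) : 0 <= x <= X -> 0 <= y <= Y ->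
  0 <= growth x y <= growth X Y.
Proof.
intros Hx Hy; unfold growth.
pose proof (pow_le x g1 (proj1 Hx)); pose proof (pow_le y g2 (proj1 Hy)).
pose proof (pow_incr x X g1 Hx); pose proof (pow_incr y Y g2 Hy).
split; [apply Rmult_le_pos|apply Rmult_le_compat]; lra.
Qed.

Lemma weight2_pos (x y : R) : 0 <= x -> 0 <= y -> 0 < weight2 g1 g2 (x, y).
Proof. intros Hx Hy; apply Rmult_lt_0_compat; now apply weight_pos. Qed.

Lemma shifts_le_nonneg : 0 <= w.
Proof.
refine (Rle_trans _ _ _ _ (Hf (t / 2) (s / 2) (0, 0) _ _ _)); try lra.
- apply Rmult_le_pos; [apply Rabs_pos|left; apply weight2_pos; lra].
- split; simpl; lra.
Qed.

Lemma step_le (h d x y : R) : 0 < h < t -> 0 < d < s -> 0 <= x -> 0 <= y ->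
  Rabs (f (x + h, y + d) - f (x, y)) <= w * growth x y.
Proof.
intros Hh Hd Hx Hy.
assert (Hw := weight2_pos x y Hx Hy).
apply (Rmult_le_reg_r (weight2 g1 g2 (x, y))); [assumption|].
replace (w * growth x y * weight2 g1 g2 (x, y)) with
  (w * (((1 + x ^ g1) * weight g1 x) * ((1 + y ^ g2) * weight g2 y)))
  by (unfold growth, weight2; simpl; ring).
rewrite !weight_inv, Rmult_1_l, Rmult_1_r by assumption.
now apply (Hf h d (x, y) Hh Hd).
Qed.

(** Telescoping along [N] equal steps; every step is charged with the growth at
    the upper end of the chain. *)
Lemma chain_le (h d x y : R) (N : nat) :
  0 < h < t -> 0 < d < s -> 0 <= x -> 0 <= y ->
  Rabs (f (x + INR N * h, y + INR N * d) - f (x, y)) <=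
  INR N * (w * growth (x + INR N * h) (y + INR N * d)).
Proof.
intros Hh Hd Hx Hy; assert (Hw := shifts_le_nonneg).
induction N as [|N IH].
- simpl INR; rewrite !Rmult_0_l, !Rplus_0_r, Rminus_diag, Rabs_R0; lra.
- set (x' := x + INR N * h) in *; set (y' := y + INR N * d) in *.
  rewrite S_INR; pose proof (pos_INR N).
  replace (x + (INR N + 1) * h) with (x' + h) by (unfold x'; ring).
  replace (y + (INR N + 1) * d) with (y' + d) by (unfold y'; ring).
  assert (Hx' : 0 <= x')
    by (apply Rplus_le_le_0_compat; [|apply Rmult_le_pos]; lra).
  assert (Hy' : 0 <= y')
    by (apply Rplus_le_le_0_compat; [|apply Rmult_le_pos]; lra).
  assert (HG := growth_le x' y' (x' + h) (y' + d) ltac:(lra) ltac:(lra)).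
  assert (HG' : w * growth x' y' <= w * growth (x' + h) (y' + d))
    by (apply Rmult_le_compat_l; lra).
  assert (Hstep := step_le h d x' y' Hh Hd Hx' Hy').
  replace (f (x' + h, y' + d) - f (x, y)) with
    ((f (x' + h, y' + d) - f (x', y')) + (f (x', y') - f (x, y))) by ring.
  apply Rle_trans with (1 := Rabs_triang _ _).
  assert (INR N * (w * growth x' y') <= INR N * (w * growth (x' + h) (y' + d)))
    by (apply Rmult_le_compat_l; lra).
  lra.
Qed.

(** The number of steps is an integer exceeding both [(X - x) / t] and
    [(Y - y) / s]: steps must be strictly shorter than [t] and [s]. *)
Lemma increment_le (x y X Y : R) : 0 <= x < X -> 0 <= y < Y ->
  Rabs (f (X, Y) - f (x, y)) <=
  (1 + (X - x) / t + (Y - y) / s) * (w * growth X Y).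
Proof.
intros Hx Hy; assert (Hw := shifts_le_nonneg).
assert (Hp : 0 < (X - x) / t) by (apply Rdiv_lt_0_compat; lra).
assert (Hq : 0 < (Y - y) / s) by (apply Rdiv_lt_0_compat; lra).
(* The sum of the two ratios serves as an upper bound of both. *)
destruct (nfloor_ex ((X - x) / t + (Y - y) / s)) as [n Hn]; [lra|].
rewrite <- S_INR in Hn; set (N := S n) in *.
assert (HN : INR N <= 1 + (X - x) / t + (Y - y) / s)
  by (unfold N; rewrite S_INR; lra).
assert (HN0 : 0 < INR N) by lra.
assert (Hstep : forall z c, 0 < z -> 0 < c -> z / c < INR N ->
  0 < z / INR N < c).
{ intros z c Hz Hc H; split; [now apply Rdiv_lt_0_compat|].
  apply (Rmult_lt_reg_r (INR N)); [assumption|].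
  apply (Rmult_lt_compat_r c) in H; [|assumption].
  unfold Rdiv in *; rewrite Rmult_assoc, Rinv_l in H by lra.
  rewrite Rmult_assoc, Rinv_l by lra; lra. }
assert (H := chain_le ((X - x) / INR N) ((Y - y) / INR N) x y N
  (Hstep (X - x) t ltac:(lra) Ht ltac:(lra))
  (Hstep (Y - y) s ltac:(lra) Hs ltac:(lra))
  (proj1 Hx) (proj1 Hy)).
replace (x + INR N * ((X - x) / INR N)) with X in H by (field; lra).
replace (y + INR N * ((Y - y) / INR N)) with Y in H by (field; lra).
apply Rle_trans with (1 := H); apply Rmult_le_compat_r; [|assumption].
apply Rmult_le_pos; [assumption|].
apply (growth_le X Y X Y); lra.
Qed.

(** Only positive shifts are controlled, so [f (x, y)] and [f (u, v)] are
    compared through a point [(X, Y)] strictly above both, at distance at most [t]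
    (resp. [s]) and at most [1] from their join: the first keeps the number of
    steps under control, the second the growth at [(X, Y)]. *)
Lemma two_point_le (x y u v : R) : 0 <= x -> 0 <= y -> 0 <= u -> 0 <= v ->
  Rabs (f (u, v) - f (x, y)) <=
  6 * w * ((1 + Rabs (u - x) / t) * (1 + (u + x + 1) ^ g1)) *
          ((1 + Rabs (v - y) / s) * (1 + (v + y + 1) ^ g2)).
Proof.
intros Hx Hy Hu Hv; assert (Hw := shifts_le_nonneg).
assert (Hup : forall p q c, 0 <= p -> 0 <= q -> 0 < c ->
  exists Z, (p < Z /\ q < Z /\ Z <= p + q + 1) /\
    (Z - p) / c <= 1 + Rabs (p - q) / c /\
    (Z - q) / c <= 1 + Rabs (p - q) / c).
{ intros p q c Hp Hq Hc; exists (Rmax p q + Rmin c 1).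
  assert (Hdiv : forall z, z <= c + Rabs (p - q) ->
    z / c <= 1 + Rabs (p - q) / c).
  { intros z Hz; apply (Rmult_le_reg_r c); [assumption|].
    unfold Rdiv; rewrite Rmult_plus_distr_r, !Rmult_assoc, Rinv_l by lra; lra. }
  split; [|split; apply Hdiv]; unfold Rmax, Rmin; repeat destruct Rle_dec;
    unfold Rabs; try destruct Rcase_abs; lra. }
destruct (Hup u x t Hu Hx Ht) as [X [HX [HXu HXx]]].
destruct (Hup v y s Hv Hy Hs) as [Y [HY [HYv HYy]]].
set (p := Rabs (u - x) / t) in *; set (q := Rabs (v - y) / s) in *.
assert (Hp : 0 <= p) by (apply Rdiv_le_0_compat; [apply Rabs_pos|lra]).
assert (Hq : 0 <= q) by (apply Rdiv_le_0_compat; [apply Rabs_pos|lra]).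
assert (Hpq : 0 <= p * q) by (now apply Rmult_le_pos).
assert (HG := growth_le X Y (u + x + 1) (v + y + 1) ltac:(lra) ltac:(lra)).
assert (HwG : w * growth X Y <= w * growth (u + x + 1) (v + y + 1))
  by (apply Rmult_le_compat_l; lra).
assert (HwG0 : 0 <= w * growth X Y) by (apply Rmult_le_pos; lra).
assert (Hmain : forall x' y', 0 <= x' < X -> 0 <= y' < Y ->
  (X - x') / t <= 1 + p -> (Y - y') / s <= 1 + q ->
  Rabs (f (X, Y) - f (x', y')) <=
  (3 * ((1 + p) * (1 + q))) * (w * growth (u + x + 1) (v + y + 1))).
{ intros x' y' Hx' Hy' H1 H2.
  apply Rle_trans with (1 := increment_le x' y' X Y Hx' Hy').
  apply Rmult_le_compat; try assumption; [|lra].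
  assert (0 <= (X - x') / t) by (apply Rdiv_le_0_compat; lra).
  assert (0 <= (Y - y') / s) by (apply Rdiv_le_0_compat; lra).
  lra. }
replace (f (u, v) - f (x, y)) with
  ((f (X, Y) - f (x, y)) - (f (X, Y) - f (u, v))) by ring.
apply Rle_trans with (1 := Rabs_triang _ _); rewrite Rabs_Ropp.
assert (H1 := Hmain x y ltac:(lra) ltac:(lra) HXx HYy).
assert (H2 := Hmain u v ltac:(lra) ltac:(lra) HXu HYv).
unfold growth in *; lra.
Qed.

End Chain.

(** * Means over grid cells *)

(** Continuity on the closed quadrant is relative, while integrability criteria
    ask for two-sided continuity, also on cells that touch the axes; the even
    extension has it and coincides with [f] on all cells. *)
Lemma continuity_2d_pt_even_extension (f : R * R -> R) (v u : R) :
  continuous_on quadrant f ->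
  continuity_2d_pt (fun v u => f (Rabs u, Rabs v)) v u.
Proof.
intros Hf eps.
assert (Hq : forall u v, quadrant (Rabs u, Rabs v))
  by (intros; split; apply Rabs_pos).
destruct (proj1 (filterlim_locally _ _) (Hf _ (Hq u v)) eps) as [d Hd].
exists d; intros v' u' Hv Hu; apply (Hd (Rabs u', Rabs v')); [|apply Hq].
split; (eapply Rle_lt_trans; [apply Rabs_triang_inv2|eassumption]).
Qed.

Lemma continuity_2d_pt_continuous (F : R -> R -> R) (v u : R) :
  continuity_2d_pt F v u -> continuous (F v) u.
Proof.
intros H; apply filterlim_locally; intros eps.
destruct (H eps) as [d Hd]; exists d; intros u' Hu.
apply Hd; [rewrite Rminus_diag, Rabs_R0; apply cond_pos|exact Hu].
Qed.

Lemma mean_value_deviation (f : R -> R) (a b c B : R) : a <= b ->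
  ex_RInt f a b -> (forall u, a <= u <= b -> Rabs (f u - c) <= B) ->
  Rabs (RInt f a b - (b - a) * c) <= (b - a) * B.
Proof.
intros Hab Hf HB.
assert (E : RInt (fun u => f u - c) a b = RInt f a b - (b - a) * c).
{ transitivity (minus (RInt f a b) (RInt (fun _ => c) a b)).
  - apply (RInt_minus (V := R_CompleteNormedModule));
      [assumption|apply ex_RInt_const].
  - rewrite RInt_const; reflexivity. }
rewrite <- E; apply abs_RInt_le_const; [assumption| |exact HB].
apply (ex_RInt_minus (V := R_NormedModule)); [assumption|apply ex_RInt_const].
Qed.

(** Uniform continuity on a compact neighbourhood of [{v} x [a, b]] makes the
    integrands uniformly close. *)
Lemma continuous_RInt_param (F : R -> R -> R) (a b v : R) : a <= b ->
  (forall v u, continuity_2d_pt F v u) ->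
  continuous (fun v => RInt (F v) a b) v.
Proof.
intros Hab HF; apply filterlim_locally; intros eps.
assert (He : 0 < eps / (b - a + 1))
  by (apply Rdiv_lt_0_compat; [apply cond_pos|lra]).
destruct (uniform_continuity_2d_1d' F a b v (fun u _ => HF v u)
  (mkposreal _ He)) as [d Hd].
assert (HI : forall w, ex_RInt (F w) a b).
{ intros w; apply (ex_RInt_continuous (V := R_CompleteNormedModule)).
  intros u _; apply continuity_2d_pt_continuous, HF. }
exists d; intros v' Hv'.
change (Rabs (RInt (F v') a b - RInt (F v) a b) < eps).
rewrite <- (RInt_minus (V := R_CompleteNormedModule)) by apply HI.
apply Rle_lt_trans with ((b - a) * (eps / (b - a + 1))).
- apply abs_RInt_le_const; [assumption| |].
  + apply (ex_RInt_minus (V := R_NormedModule)); apply HI.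
  + intros u Hu; left; change (Rabs (v' - v) < d) in Hv'.
    apply Rabs_lt_between in Hv'; pose proof (cond_pos d).
    apply (Hd u v u v'); try lra.
    rewrite Rminus_diag, Rabs_R0; assumption.
- pose proof (cond_pos eps).
  apply (Rmult_lt_reg_r (b - a + 1)); [lra|].
  replace ((b - a) * (eps / (b - a + 1)) * (b - a + 1)) with ((b - a) * eps)
    by (field; lra).
  lra.
Qed.

Lemma double_mean_value_deviation (F : R -> R -> R) (a b c d z B : R) :
  a <= b -> c <= d -> (forall v u, continuity_2d_pt F v u) ->
  (forall u v, a <= u <= b -> c <= v <= d -> Rabs (F v u - z) <= B) ->
  Rabs (RInt (fun v => RInt (F v) a b) c d - (d - c) * ((b - a) * z)) <=
  (d - c) * ((b - a) * B).
Proof.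
intros Hab Hcd HF HB; apply mean_value_deviation; [assumption| |].
- apply (ex_RInt_continuous (V := R_CompleteNormedModule)).
  intros v _; now apply continuous_RInt_param.
- intros v Hv; apply mean_value_deviation; [assumption| |auto].
  apply (ex_RInt_continuous (V := R_CompleteNormedModule)).
  intros u _; apply continuity_2d_pt_continuous, HF.
Qed.

Lemma RInt_even_extension (f : R * R -> R) (a b c d : R) :
  0 <= a <= b -> 0 <= c <= d ->
  RInt (fun v => RInt (fun u => f (u, v)) a b) c d =
  RInt (fun v => RInt (fun u => f (Rabs u, Rabs v)) a b) c d.
Proof.
intros Hab Hcd; apply RInt_ext; intros v; rewrite Rmin_left, Rmax_right by lra.
intros Hv; apply RInt_ext; intros u; rewrite Rmin_left, Rmax_right by lra.
intros Hu; rewrite !Rabs_pos_eq by lra; reflexivity.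
Qed.

Definition in_cell (n k : nat) (u : R) : Prop :=
  INR k / INR (n + 1) <= u <= INR (k + 1) / INR (n + 1).

Lemma cell_bounds (n k : nat) :
  0 <= INR k / INR (n + 1) <= INR (k + 1) / INR (n + 1).
Proof.
assert (0 < INR (n + 1)) by (apply lt_0_INR; lia).
pose proof (pos_INR k); rewrite (plus_INR k 1); simpl (INR 1).
split; [apply Rdiv_le_0_compat; lra|].
apply Rmult_le_compat_r; [left; now apply Rinv_0_lt_compat|lra].
Qed.

Lemma cell_length (n k : nat) :
  INR (n + 1) * (INR (k + 1) / INR (n + 1) - INR k / INR (n + 1)) = 1.
Proof.
assert (0 < INR (n + 1)) by (apply lt_0_INR; lia).
rewrite (plus_INR k 1); simpl (INR 1); field; lra.
Qed.

Definition cell_integral (n1 n2 : nat) (f : R * R -> R) (k1 k2 : nat) : R :=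
  RInt (fun v => RInt (fun u => f (u, v))
    (INR k1 / INR (n1 + 1)) (INR (k1 + 1) / INR (n1 + 1)))
    (INR k2 / INR (n2 + 1)) (INR (k2 + 1) / INR (n2 + 1)).

Lemma cell_mean_deviation (n1 n2 : nat) (f : R * R -> R) (k1 k2 : nat)
    (z B : R) :
  continuous_on quadrant f ->
  (forall u v, in_cell n1 k1 u -> in_cell n2 k2 v ->
    Rabs (f (u, v) - z) <= B) ->
  Rabs (INR (n1 + 1) * INR (n2 + 1) * cell_integral n1 n2 f k1 k2 - z) <= B.
Proof.
intros Hf HB; unfold cell_integral.
assert (Hc1 := cell_bounds n1 k1); assert (Hc2 := cell_bounds n2 k2).
rewrite RInt_even_extension by assumption.
assert (H := double_mean_value_deviation (fun v u => f (Rabs u, Rabs v))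
  _ _ _ _ z B (proj2 Hc1) (proj2 Hc2)
  (fun v u => continuity_2d_pt_even_extension f v u Hf)).
assert (HN : 0 < INR (n1 + 1) * INR (n2 + 1))
  by (apply Rmult_lt_0_compat; apply lt_0_INR; lia).
assert (E1 := cell_length n1 k1); assert (E2 := cell_length n2 k2).
match type of H with _ -> Rabs (?I - ?d2 * (?d1 * _)) <= _ =>
  set (I0 := I) in *; set (l1 := d1) in *; set (l2 := d2) in * end.
assert (EN : INR (n1 + 1) * INR (n2 + 1) * (l2 * l1) = 1).
{ replace (_ * (l2 * l1)) with
    ((INR (n1 + 1) * l1) * (INR (n2 + 1) * l2)) by ring.
  rewrite E1, E2; ring. }
replace (INR (n1 + 1) * INR (n2 + 1) * I0 - z) with
  (INR (n1 + 1) * INR (n2 + 1) * (I0 - l2 * (l1 * z))).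
2: { transitivity (INR (n1 + 1) * INR (n2 + 1) * I0 -
       INR (n1 + 1) * INR (n2 + 1) * (l2 * l1) * z); [ring|].
     rewrite EN; ring. }
rewrite Rabs_mult, Rabs_pos_eq by lra.
apply Rle_trans with (INR (n1 + 1) * INR (n2 + 1) * (l2 * (l1 * B))).
- apply Rmult_le_compat_l; [lra|]; apply H.
  intros u v Hu Hv; rewrite (Rabs_pos_eq u), (Rabs_pos_eq v) by lra.
  now apply HB.
- right; rewrite <- (Rmult_1_l B) at 2; rewrite <- EN; ring.
Qed.

(** * The operator *)

Lemma K_as_iterated_mean (a : R) (n1 n2 : nat) (f : R * R -> R) (x y : R) :
  K a n1 n2 f x y = Series (fun k1 => W a n1 k1 x *
    Series (fun k2 => W a n2 k2 y *
      (INR (n1 + 1) * INR (n2 + 1) * cell_integral n1 n2 f k1 k2))).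
Proof.
unfold K; rewrite <- Series_scal_l; apply Series_ext; intros k1.
rewrite <- !Series_scal_l; apply Series_ext; intros k2.
unfold W2, cell_integral; ring.
Qed.

(** An average of values close to [c] is close to [c].  The estimate carries the
    convergence of the series with it, by comparison with the majorant [h]. *)
Lemma Series_weighted_deviation (w m h : nat -> R) (c E A : R) :
  (forall k, 0 <= w k) -> is_series w 1 -> 0 <= E -> (forall k, 0 <= h k) ->
  partial_sums_le (fun k => w k * h k) A ->
  (forall k, Rabs (m k - c) <= E * h k) ->
  Rabs (Series (fun k => w k * m k) - c) <= E * A.
Proof.
intros Hw H1 HE Hh HA Hm.
set (e k := w k * (m k - c)).
assert (Hwh : forall k, 0 <= w k * h k) by (intros k; now apply Rmult_le_pos).
destruct (partial_sums_le_is_series _ A Hwh HA) as [l [Hl HlA]].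
assert (HS : is_series (fun k => E * (w k * h k)) (E * l))
  by exact (is_series_scal E _ _ Hl).
assert (He : forall k, Rabs (e k) <= E * (w k * h k)).
{ intros k; unfold e; rewrite Rabs_mult, (Rabs_pos_eq (w k)) by apply Hw.
  replace (E * (w k * h k)) with (w k * (E * h k)) by ring.
  apply Rmult_le_compat_l; [apply Hw|apply Hm]. }
assert (Hex : ex_series (fun k => Rabs (e k))).
{ apply (ex_series_le (V := R_CompleteNormedModule)) with
    (2 := ex_intro _ _ HS).
  intros k; change (Rabs (Rabs (e k)) <= E * (w k * h k)).
  rewrite Rabs_Rabsolu; apply He. }
assert (E1 : Series (fun k => w k * m k) = c + Series e).
{ apply is_series_unique.
  replace (c + Series e) with (plus (scal c 1) (Series e))
    by (unfold plus, scal; simpl; unfold mult; simpl; ring).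
  refine (is_series_ext _ _ _ _ (is_series_plus _ _ _ _
    (is_series_scal c _ _ H1) (Series_correct _ (ex_series_Rabs _ Hex)))).
  - intros k; unfold e; change (c * w k + w k * (m k - c) = w k * m k); ring. }
rewrite E1; replace (c + Series e - c) with (Series e) by ring.
apply Rle_trans with (1 := Series_Rabs _ Hex).
apply Rle_trans with (E * l); [|now apply Rmult_le_compat_l].
rewrite <- (is_series_unique _ _ HS); apply Series_le; [|eexists; exact HS].
intros k; split; [apply Rabs_pos|apply He].
Qed.

(** The constant is [6] from [two_point_le] times a factor [4] from
    [deviation_le_cell_majorant] for each coordinate. *)
Lemma cell_increment_le (a : R) (g1 g2 : nat) (f : R * R -> R) (x y w : R)
    (n1 n2 k1 k2 : nat) (u v : R) :
  0 <= a -> 0 <= x -> 0 <= y -> (1 <= n1)%nat -> (1 <= n2)%nat ->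
  shifts_le g1 g2 f (delta a n1 x / sqrt (INR (n1 + 1)))
    (delta a n2 y / sqrt (INR (n2 + 1))) w ->
  in_cell n1 k1 u -> in_cell n2 k2 v ->
  Rabs (f (u, v) - f (x, y)) <=
  96 * w * (1 + x ^ g1) * (1 + y ^ g2) * cell_majorant g1 n1 x k1 *
    cell_majorant g2 n2 y k2.
Proof.
intros Ha Hx Hy Hn1 Hn2 Hmod Hu Hv.
assert (Ht := delta_pos a n1 x Ha Hx); assert (Hs := delta_pos a n2 y Ha Hy).
assert (Hdev1 := deviation_le_cell_majorant a g1 n1 k1 x u Ha Hx Hn1 Hu).
assert (Hdev2 := deviation_le_cell_majorant a g2 n2 k2 y v Ha Hy Hn2 Hv).
set (t := delta a n1 x / sqrt (INR (n1 + 1))) in *.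
set (s := delta a n2 y / sqrt (INR (n2 + 1))) in *.
assert (Hw := shifts_le_nonneg g1 g2 f t s w Ht Hs Hmod).
assert (Hu0 : 0 <= u) by (apply Rle_trans with (2 := proj1 Hu), cell_bounds).
assert (Hv0 : 0 <= v) by (apply Rle_trans with (2 := proj1 Hv), cell_bounds).
assert (Hfactor : forall g m z p q c, 0 <= z -> 0 <= q -> 0 < c ->
  (1 + Rabs (q - z) / c) * (p * weight g z) <= 4 * m -> 0 <= p ->
  0 <= (1 + Rabs (q - z) / c) * p <= 4 * m * (1 + z ^ g)).
{ intros g m z p q c Hz Hq Hc H Hp; split.
  - apply Rmult_le_pos; [|assumption].
    apply Rplus_le_le_0_compat; [lra|].
    apply Rdiv_le_0_compat; [apply Rabs_pos|assumption].
  - apply (Rmult_le_reg_r (weight g z)); [now apply weight_pos|].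
    rewrite (Rmult_assoc (4 * _)), weight_inv by assumption; lra. }
assert (Hpow : forall g q z, 0 <= q -> 0 <= z -> 0 <= 1 + (q + z + 1) ^ g).
{ intros g q z Hq Hz; apply Rplus_le_le_0_compat; [lra|apply pow_le; lra]. }
assert (Hp := Hfactor _ _ _ _ _ _ Hx Hu0 Ht Hdev1 (Hpow _ _ _ Hu0 Hx)).
assert (Hq := Hfactor _ _ _ _ _ _ Hy Hv0 Hs Hdev2 (Hpow _ _ _ Hv0 Hy)).
apply Rle_trans with
  (1 := two_point_le g1 g2 f t s w Ht Hs Hmod x y u v Hx Hy Hu0 Hv0).
apply Rle_trans with (6 * w * (4 * cell_majorant g1 n1 x k1 * (1 + x ^ g1)) *
  (4 * cell_majorant g2 n2 y k2 * (1 + y ^ g2))); [|right; ring].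
apply Rmult_le_compat; [|apply Hq| |apply Hq].
- apply Rmult_le_pos; [lra|apply Hp].
- apply Rmult_le_compat_l; [lra|apply Hp].
Qed.

Theorem theorem3 :
  forall (a : R) (g1 g2 : nat), 0 <= a ->
  exists M9 : R, 0 < M9 /\
    forall (f : R * R -> R), weighted_C g1 g2 f ->
    forall (x y : R), quadrant (x, y) ->
    forall (n1 n2 : nat), (1 <= n1)%nat -> (1 <= n2)%nat ->
    Rbar_le
      (Finite (weight2 g1 g2 (x, y) * Rabs (K a n1 n2 f x y - f (x, y))))
      (Rbar_mult (Finite M9)
         (modulus g1 g2 f (delta a n1 x / sqrt (INR (n1 + 1)))
                          (delta a n2 y / sqrt (INR (n2 + 1))))).
Proof.
intros a g1 g2 Ha.
destruct (W_cell_majorant_bound a g1 Ha) as [A1 [HA1 HB1]].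
destruct (W_cell_majorant_bound a g2 Ha) as [A2 [HA2 HB2]].
assert (HM : 0 < 96 * A2 * A1) by (repeat apply Rmult_lt_0_compat; lra).
exists (96 * A2 * A1); split; [assumption|].
intros f [Hf _] x y Hxy n1 n2 Hn1 Hn2.
assert (Hx : 0 <= x) by apply Hxy; assert (Hy : 0 <= y) by apply Hxy.
assert (Ht := delta_pos a n1 x Ha Hx); assert (Hs := delta_pos a n2 y Ha Hy).
assert (Hincr := fun w k1 k2 u v =>
  cell_increment_le a g1 g2 f x y w n1 n2 k1 k2 u v Ha Hx Hy Hn1 Hn2).
set (t := delta a n1 x / sqrt (INR (n1 + 1))) in *.
set (s := delta a n2 y / sqrt (INR (n2 + 1))) in *.
assert (Hmod := shifts_le_modulus g1 g2 f t s).
assert (Hninf := modulus_not_m_infty g1 g2 f t s Ht Hs).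
destruct (modulus g1 g2 f t s) as [w| |].
2: { replace (Rbar_mult (Finite _) p_infty) with p_infty; [exact I|].
     symmetry; apply is_Rbar_mult_unique, is_Rbar_mult_sym.
     now apply is_Rbar_mult_p_infty_pos. }
2: now destruct Hninf.
specialize (Hmod w eq_refl).
assert (Hw := shifts_le_nonneg g1 g2 f t s w Ht Hs Hmod).
assert (Hm1 : forall k, 0 <= cell_majorant g1 n1 x k)
  by (intros; now apply cell_majorant_nonneg).
assert (Hm2 : forall k, 0 <= cell_majorant g2 n2 y k)
  by (intros; now apply cell_majorant_nonneg).
set (D := 96 * w * (1 + x ^ g1) * (1 + y ^ g2)) in *.
assert (HD : 0 <= D).
{ pose proof (pow_le x g1 Hx); pose proof (pow_le y g2 Hy).
  unfold D; repeat apply Rmult_le_pos; lra. }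
assert (H : Rabs (K a n1 n2 f x y - f (x, y)) <= D * A2 * A1).
{ rewrite K_as_iterated_mean.
  apply Series_weighted_deviation with (h := cell_majorant g1 n1 x); auto.
  - intros k; now apply W_nonneg.
  - now apply is_series_W.
  - apply Rmult_le_pos; lra.
  - intros k1.
    replace (D * A2 * cell_majorant g1 n1 x k1) with
      (D * cell_majorant g1 n1 x k1 * A2) by ring.
    apply Series_weighted_deviation with (h := cell_majorant g2 n2 y); auto.
    + intros k; now apply W_nonneg.
    + now apply is_series_W.
    + now apply Rmult_le_pos.
    + intros k2; apply cell_mean_deviation; [assumption|].
      intros u v Hu Hv; exact (Hincr w k1 k2 u v Hmod Hu Hv). }
simpl.
apply Rle_trans with (weight2 g1 g2 (x, y) * (D * A2 * A1)).
- apply Rmult_le_compat_l; [|assumption].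
  now apply Rlt_le, weight2_pos.
- right; unfold weight2, D; simpl.
  transitivity (96 * A2 * A1 * w * ((1 + x ^ g1) * weight g1 x) *
    ((1 + y ^ g2) * weight g2 y)); [ring|].
  rewrite !weight_inv by assumption; ring.
Qed.
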